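(* Let $p$ be an odd prime, $\epsilon_0\in\{1,-1\}$, and $n,s$ non-negative integers with $s\ge1$ if $p=3$. If $n=4+s$, there exists a $p$-ary pure quantum code with parameters $[[\frac{p^{n-1}-\epsilon_0p^{n-3}}{2},\,\frac{p^{n-1}-\epsilon_0p^{n-3}}{2}-n-2,\,3]]_p$, which is at least almost optimal according to the quantum Hamming bound. If $n=3+s$, there exists a $p$-ary pure quantum code with parameters $[[\frac{p^{n-1}+\epsilon_0p^{n-2}}{2},\,\frac{p^{n-1}+\epsilon_0p^{n-2}}{2}-n-2,\,3]]_p$, which is at least almost optimal according to the quantum Hamming bound.
   Context: A $p$-ary $[[N,K,d]]_p$ quantum code is a $p^K$-dimensional subspace $Q$ of $\mathbb{C}^{p^N}$ with minimum distance $d$; it is pure if $\langle v_1|E|v_2\rangle=0$ for all $v_1,v_2\in Q$ and every error operator $E$ of quantum weight between $1$ and $d-1$. The quantum Hamming bound for a pure $[[N,K,d]]_p$ code is $p^{N-K}\ge\sum_{j=0}^{\lfloor(d-1)/2\rfloor}\binom{N}{j}(p^2-1)^j$. An $[[N,K,d]]_p$ code is optimal if no $[[N,K,d+1]]_p$ code exists, almost optimal if an optimal $[[N,K,d+1]]_p$ code exists; ''at least almost optimal according to the quantum Hamming bound'' means the quantum Hamming bound certifies it is optimal or almost optimal for its length and dimension. *)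

(* Defs.v *)
From HB Require Import structures.
From mathcomp Require Import all_boot all_order all_algebra all_field.
Set Implicit Arguments. Unset Strict Implicit. Unset Printing Implicit Defensive.
Import Order.TTheory GRing.Theory Num.Theory.
Local Open Scope ring_scope.

(* A fixed primitive p-th root of unity in algC (for p > 0, p.-1.+1 = p). *)
Definition omega (p : nat) : algC := sval (C_prim_root_exists (ltn0Sn p.-1)).

(* Computational basis of (C^p)^{tensor N}: words x in F_p^N. *)
Definition qword (p N : nat) := {ffun 'I_N -> 'F_p}.

Definition qstate (p N : nat) := {ffun qword p N -> algC^o}.

(* Error operators E(a,b) = X(a) Z(b):
   X(a)|x> = |x + a>,  Z(b)|x> = omega^(b.x) |x>. *)
Definition Zop (p N : nat) (b : qword p N) (v : qstate p N) : qstate p N :=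
  [ffun y : qword p N => omega p ^+ (nat_of_ord (\sum_i b i * y i : 'F_p)) * v y].
Definition Xop (p N : nat) (a : qword p N) (v : qstate p N) : qstate p N :=
  [ffun y : qword p N => v [ffun i => y i - a i]].
Definition errop (p N : nat) (a b : qword p N) (v : qstate p N) : qstate p N :=
  Xop a (Zop b v).

Definition qweight (p N : nat) (a b : qword p N) : nat :=
  #|[set i : 'I_N | (a i != 0) || (b i != 0)]|.

Definition braket (p N : nat) (v1 w : qstate p N) : algC :=
  \sum_y (v1 y)^* * w y.

Definition detectable (p N : nat) (Q : {vspace qstate p N}) (a b : qword p N) :=
  exists c : algC, forall v1 v2, v1 \in Q -> v2 \in Q ->
    braket v1 (errop a b v2) = c * braket v1 v2.

Definition is_qcode (p N K d : nat) (Q : {vspace qstate p N}) : Prop :=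
  [/\ \dim Q = (p ^ K)%N,
      (forall a b, (qweight a b < d)%N -> detectable Q a b) &
      (exists a b, qweight a b = d /\ ~ detectable Q a b)].

Definition is_pure (p N d : nat) (Q : {vspace qstate p N}) : Prop :=
  forall a b, (1 <= qweight a b <= d.-1)%N ->
    forall v1 v2, v1 \in Q -> v2 \in Q -> braket v1 (errop a b v2) = 0.

Definition qhamming_bound (p N K d : nat) : bool :=
  (\sum_(j < (d.-1)./2.+1) 'C(N, j) * (p ^ 2 - 1) ^ j <= p ^ (N - K))%N.

(* Main.v *)
(* A stabilizer code with n + 2 generators is given by N pairwise skew lines <a_x, b_x> of
   F_p^(n+2) that span the space and satisfy sum_x (a_x /\ b_x) = 0; it is pure of distance >= 3
   because two skew lines span a 4-dimensional space.  Index the lines by N distinct points x of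
   F_p^n and take a_x = (1, 0, x) and b_x = (0, 1, x A), where A has no eigenvalue in F_p: then
   distinct points give skew lines, and the sum vanishes as soon as the moments of order 0, 1, 2
   of the point set do.  A union of parallel affine subspaces has vanishing moments if these have
   dimension >= 1 (>= 2 when p = 3), and both lengths N are realized by such unions.  The trace
   formula for idempotents gives the dimension of the code and shows that an error commuting with
   the stabilizer but outside it is not detectable; the second difference (1, -2, 1) on three
   points of a line is such an error, of weight 3. *)
Require Import Defs.
From HB Require Import structures.
From mathcomp Require Import all_boot all_order all_algebra all_field.
From mathcomp Require Import ring zify.
Import Order.TTheory GRing.Theory Num.Theory.
Local Open Scope ring_scope.
Set Implicit Arguments. Unset Strict Implicit. Unset Printing Implicit Defensive.

(** * Additive characters of the prime field *)

Definition chi (p : nat) (c : 'F_p) : algC := omega p ^+ nat_of_ord c.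

Definition dot (p N : nat) (a b : qword p N) : 'F_p := \sum_i a i * b i.

Lemma dotC p N (a b : qword p N) : dot a b = dot b a.
Proof. by apply: eq_bigr => i _; rewrite mulrC. Qed.

Lemma dotDl p N (a b c : qword p N) : dot (a + b) c = dot a c + dot b c.
Proof. by rewrite -big_split; apply: eq_bigr => i _; rewrite ffunE mulrDl. Qed.

Lemma dotBr p N (a b c : qword p N) : dot a (b - c) = dot a b - dot a c.
Proof. by rewrite -sumrB; apply: eq_bigr => i _; rewrite !ffunE mulrBr. Qed.

Lemma dot0l p N (z : qword p N) : dot 0 z = 0.
Proof. by rewrite /dot big1 // => i _; rewrite ffunE mul0r. Qed.

Lemma two_unit p : prime p -> odd p -> (2%:R : 'F_p) != 0.
Proof.
move=> p_pr p_odd; rewrite -(dvdn_pcharf (pchar_Fp p_pr)) (dvdn_prime2 p_pr) //.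
by apply: contraTneq p_odd => ->.
Qed.

Lemma three_unit p : prime p -> p != 3%N -> (3%:R : 'F_p) != 0.
Proof.
by move=> p_pr; rewrite -(dvdn_pcharf (pchar_Fp p_pr)) (dvdn_prime2 p_pr).
Qed.

Section Characters.
Variable p : nat.
Hypothesis p_pr : prime p.

Lemma omega_prim : p.-primitive_root (omega p).
Proof.
have := svalP (C_prim_root_exists (ltn0Sn p.-1)).
by rewrite -/(omega p) prednK ?prime_gt0.
Qed.

Lemma chi0 : chi (0 : 'F_p) = 1.
Proof. by []. Qed.

Lemma chiD (c d : 'F_p) : chi (c + d) = chi c * chi d.
Proof.
rewrite /chi -exprD -(prim_expr_mod omega_prim (c + d)%N) /=.
by congr (_ ^+ (_ %% _)); exact: Fp_cast.
Qed.

Lemma chi_eq1 (c : 'F_p) : (chi c == 1) = (c == 0).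
Proof.
rewrite /chi -(prim_order_dvd omega_prim); apply/idP/eqP => [|->]; last exact: dvdn0.
have lt_cp : (c < p)%N by rewrite -[X in (_ < X)%N](Fp_cast p_pr).
by case: (posnP c) => [c0 _|c_gt0 /dvdn_leq]; [exact: val_inj | lia].
Qed.

Lemma chi_unit (c : 'F_p) : (chi c)^* * chi c = 1.
Proof.
have norm_omega : `|omega p| = 1.
  apply/eqP; rewrite -(@pexpr_eq1 _ _ p) ?prime_gt0 //.
  by rewrite -normrX (prim_expr_order omega_prim) normr1.
by rewrite mulrC -normCK normrX norm_omega !expr1n.
Qed.

(** Orthogonality of characters: if [b i] is nonzero, translating [y] by the unit vector at [i]
    multiplies the sum by [chi (b i)], which differs from 1. *)
Lemma sum_chi_dot N (b : qword p N) :
  \sum_(y : qword p N) chi (dot b y) = if b == 0 then (p ^ N)%:R else 0.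
Proof.
case: eqVneq => [->|b_neq0].
  transitivity (\sum_(y : qword p N) (1 : algC)).
    apply: eq_bigr => y _; rewrite /dot big1 ?chi0 // => i _.
    by rewrite ffunE mul0r.
  by rewrite sumr_const card_ffun card_Fp ?card_ord.
have [i bi_neq0] : exists i, b i != 0.
  by apply/existsP; rewrite -negb_forall; apply: contra b_neq0 => /forallP b0;
    apply/eqP/ffunP=> i; rewrite ffunE; apply/eqP; exact: b0.
pose e : qword p N := [ffun j => (j == i)%:R].
have dote y : dot b (y + e) = dot b y + b i.
  have <- : \sum_j b j * e j = b i.
    rewrite (bigD1 i) //= big1 => [|j /negbTE jNi]; first by rewrite ffunE eqxx mulr1 addr0.
    by rewrite ffunE jNi mulr0.
  by rewrite -big_split; apply: eq_bigr => j _; rewrite !ffunE mulrDr.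
have : (chi (b i) - 1) * \sum_(y : qword p N) chi (dot b y) = 0.
  rewrite mulrBl mul1r mulr_sumr.
  under eq_bigr do rewrite -chiD addrC -dote.
  by rewrite [X in _ - X](reindex_inj (addIr e)) subrr.
by move/eqP; rewrite mulf_eq0 subr_eq0 chi_eq1 (negbTE bi_neq0) => /eqP.
Qed.

End Characters.

(* The rank of an idempotent is its trace, computed in the delta basis. *)
Lemma dim_limg_idem (Y : finType) (P : 'End({ffun Y -> algC^o})) :
  (forall v, P (P v) = P v) ->
  (\dim (limg P))%:R = \sum_y P [ffun z => (z == y)%:R] y.
Proof.
move=> PP.
set e := vbasis (limg P).
have basis_e : basis_of (limg P) e := vbasisP _.
have Pe i : P e`_i = e`_i.
  have [lt_i|ge_i] := ltnP i (\dim (limg P)); last by rewrite nth_default ?size_tuple ?linear0.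
  have /memv_imgP[w _ ->] : e`_i \in limg P.
    by apply: vbasis_mem; rewrite mem_nth ?size_tuple.
  exact: PP.
have ffun_delta (v : {ffun Y -> algC^o}) : v = \sum_y (v y : algC) *: [ffun z => (z == y)%:R].
  apply/ffunP => z; rewrite sum_ffunE (bigD1 z) //= big1 ?addr0 => [|y yNz].
    by rewrite !ffunE eqxx /GRing.scale /= mulr1.
  by rewrite !ffunE eq_sym (negbTE yNz) scaler0.
transitivity (\sum_(i < \dim (limg P)) (1 : algC)); first by rewrite sumr_const card_ord.
transitivity (\sum_(i < \dim (limg P)) coord e i (P e`_i)).
  apply: eq_bigr => i _; rewrite Pe coord_free ?eqxx //.
  exact: basis_free basis_e.
(* Expanding each basis vector of the image in delta functions and exchanging the sums turns the
   trace on the image into the trace in the delta basis. *)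
transitivity (\sum_(i < \dim (limg P))
                 \sum_y (e`_i y : algC) * coord e i (P [ffun z => (z == y)%:R])).
  apply: eq_bigr => i _; rewrite [in LHS](ffun_delta e`_i) !linear_sum.
  by apply: eq_bigr => y _; rewrite !linearZ.
rewrite exchange_big; apply: eq_bigr => y _.
have Pin : P [ffun z => (z == y)%:R] \in limg P by rewrite memv_img ?memvf.
rewrite [in RHS](coord_basis basis_e Pin) sum_ffunE.
by apply: eq_bigr => i _; rewrite !ffunE mulrC.
Qed.

(** * Stabilizer codes *)

Lemma erropE p N (x z : qword p N) (v : qstate p N) y :
  errop x z v y = chi (dot z (y - x)) * v (y - x).
Proof.
rewrite /errop !ffunE.
have -> : [ffun i => y i - x i] = y - x by apply/ffunP=> i; rewrite !ffunE.
by [].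
Qed.

Lemma errop00 p N (v : qstate p N) : errop 0 0 v = v.
Proof. by apply/ffunP => y; rewrite erropE subr0 dot0l chi0 mul1r. Qed.

Section Braket.
Variables p N : nat.
Implicit Types u v w : qstate p N.

Lemma braketZr c v w : braket v (c *: w) = c * braket v w.
Proof. by rewrite mulr_sumr; apply: eq_bigr => y _; rewrite ffunE mulrCA. Qed.

Lemma braketBr u v w : braket u (v - w) = braket u v - braket u w.
Proof. by rewrite -sumrB; apply: eq_bigr => y _; rewrite !ffunE mulrBr. Qed.

Lemma braket_eq0 v : braket v v = 0 -> v = 0.
Proof.
move=> vv0; apply/ffunP => y; rewrite ffunE.
have vy_ge0 z : true -> 0 <= (v z)^* * v z by rewrite mulrC -normCK exprn_ge0.
have /eqP := @psumr_eq0P _ _ _ _ vy_ge0 vv0 y isT.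
by rewrite mulrC -normCK expf_eq0 /= normr_eq0 => /eqP.
Qed.

End Braket.

Lemma additive0 (U V : zmodType) (f : U -> V) :
  (forall s t, f (s + t) = f s + f t) -> f 0 = 0.
Proof. by move=> fD; apply: (addrI (f 0)); rewrite -fD !addr0. Qed.

Section Stabilizer.
Variables (p N r : nat) (V : finZmodType) (a b : V -> qword p N).
Hypotheses (p_pr : prime p) (p_odd : odd p).
Hypotheses (aD : forall s t, a (s + t) = a s + a t)
           (bD : forall s t, b (s + t) = b s + b t).
Hypothesis ab_isotropic : forall s t, dot (a s) (b t) = dot (a t) (b s).
Hypothesis ab_inj : forall t, a t = 0 -> b t = 0 -> t = 0.
Hypothesis cardV : #|V| = (p ^ r)%N.
Hypothesis le_rN : (r <= N)%N.

(* The factor 1/2 makes t |-> stab t a representation of V. *)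
Let phase t : 'F_p := dot (a t) (b t) / 2%:R.

(** The error operator [errop (a t) (b t)] rescaled by the scalar [chi (phase t)]. *)
Definition stab t (v : qstate p N) : qstate p N :=
  [ffun y : qword p N => chi (phase t + dot (b t) (y - a t)) * v (y - a t)].

Lemma stabE t v y :
  stab t v y = chi (phase t + dot (b t) (y - a t)) * v (y - a t).
Proof. by rewrite ffunE. Qed.

(** By isotropy the two cross terms of [phase (s + t)] are equal, and their half sum cancels the
    extra term [dot (b s) (a t)] of the exponent. *)
Lemma stabD s t v : stab (s + t) v = stab s (stab t v).
Proof.
apply/ffunP => y; rewrite !ffunE mulrA -chiD //.
have -> : y - a (s + t) = y - a s - a t by rewrite aD opprD addrA.
congr (chi _ * _); rewrite /phase aD bD !dotDl ![dot _ (b s + b t)]dotC !dotDl.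
rewrite ![dot (b _) (a _)]dotC (ab_isotropic t s) !dotBr ![dot (b _) (a _)]dotC (ab_isotropic t s).
by have := two_unit p_pr p_odd; move: (dot _ _) => *; field.
Qed.

Lemma braket_stab t v w : braket (stab t v) (stab t w) = braket v w.
Proof.
rewrite /braket [RHS](reindex_inj (addIr (- a t))); apply: eq_bigr => y _.
rewrite !ffunE rmorphM /= mulrACA chi_unit // mul1r //.
Qed.

(** Weyl commutation relation: the factor is the character of the symplectic form of [(a t, b t)]
    and [(x, z)]. *)
Lemma stab_errop t x z v :
  stab t (errop x z v) = chi (dot (b t) x - dot (a t) z) *: errop x z (stab t v).
Proof.
apply/ffunP => y; rewrite stabE [RHS]ffunE !erropE stabE.
have e3 : y - a t - x = y - x - a t by rewrite addrAC.
rewrite /GRing.scale /= e3 !mulrA -!chiD //; congr (chi _ * _).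
rewrite !dotBr [dot z (a t)]dotC; ring.
Qed.

(** Averaging over the representation [stab] is the projector onto the vectors fixed by all
    [stab t]. *)
Definition stab_avg (v : qstate p N) : qstate p N := (#|V|%:R : algC)^-1 *: \sum_t stab t v.

Lemma stab_is_linear t : linear (stab t).
Proof.
move=> c u v; apply/ffunP => y; rewrite !ffunE /GRing.scale /= mulrDr; congr (_ + _).
by rewrite mulrCA.
Qed.

Lemma stab_avg_is_linear : linear stab_avg.
Proof.
move=> c u v; rewrite /stab_avg.
under eq_bigr do rewrite stab_is_linear.
by rewrite big_split -scaler_sumr /= scalerDr !scalerA mulrC.
Qed.

HB.instance Definition _ :=
  GRing.isLinear.Build _ (qstate p N) (qstate p N) _ stab_avg stab_avg_is_linear.

Definition stab_code : {vspace qstate p N} := limg (linfun stab_avg).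

Lemma card_V_neq0 : (#|V|%:R : algC) != 0.
Proof. by rewrite pnatr_eq0 cardV expn_eq0; case: p p_pr. Qed.

Lemma stab_stab_avg t v : stab t (stab_avg v) = stab_avg v.
Proof.
rewrite /stab_avg.
have stabZ c u : stab t (c *: u) = c *: stab t u.
  by apply/ffunP => y; rewrite !ffunE /GRing.scale /= mulrCA.
have stab_sum : stab t (\sum_s stab s v) = \sum_s stab t (stab s v).
  apply/ffunP => y; rewrite sum_ffunE ffunE sum_ffunE mulr_sumr.
  by apply: eq_bigr => s _; rewrite [in RHS]ffunE.
rewrite stabZ stab_sum; congr (_ *: _).
rewrite [RHS](reindex_inj (addrI t)).
by apply: eq_bigr => s _; rewrite stabD.
Qed.

Lemma stab_codeP v : reflect (forall t, stab t v = v) (v \in stab_code).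
Proof.
apply: (iffP idP) => [/memv_imgP[w _ ->] t|stab_v].
  by rewrite lfunE stab_stab_avg.
apply/memv_imgP; exists v; first exact: memvf.
rewrite lfunE /= /stab_avg (eq_bigr (fun=> v)) // sumr_const.
by rewrite -scaler_nat scalerA mulVf ?card_V_neq0 ?scale1r.
Qed.

(** A nonzero shift has no diagonal entry, and a nontrivial phase sums to 0 by orthogonality. *)
Lemma errop_trace (x z : qword p N) :
  \sum_(y : qword p N) errop x z [ffun u => (u == y)%:R] y =
    if (x == 0) && (z == 0) then (p ^ N)%:R else 0.
Proof.
case: eqVneq => [->|x_neq0].
  rewrite -sum_chi_dot //; apply: eq_bigr => y _.
  by rewrite erropE ffunE subr0 eqxx mulr1.
rewrite big1 // => y _; rewrite erropE ffunE.
by rewrite -subr_eq0 addrAC subrr add0r oppr_eq0 (negbTE x_neq0) mulr0.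
Qed.

Lemma errop_stab x z t v :
  errop x z (stab t v) = chi (phase t + dot z (a t)) *: errop (x + a t) (z + b t) v.
Proof.
apply/ffunP => y; rewrite [RHS]ffunE !erropE stabE /GRing.scale /=.
have -> : y - (x + a t) = y - x - a t by rewrite opprD addrA.
rewrite !mulrA -!chiD //; congr (chi _ * _).
rewrite !dotDl !dotBr; ring.
Qed.

(** Only those [t] whose product with the error is a scalar operator contribute to the trace. *)
Lemma errop_stab_avg_trace (x z : qword p N) :
  \sum_(y : qword p N) errop x z (stab_avg [ffun u => (u == y)%:R]) y =
    #|V|%:R^-1 * \sum_(t | (x + a t == 0) && (z + b t == 0))
                     chi (phase t + dot z (a t)) * (p ^ N)%:R.
Proof.
transitivity (\sum_(y : qword p N) #|V|%:R^-1 * \sum_t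
     (chi (phase t + dot z (a t)) * errop (x + a t) (z + b t) [ffun u => (u == y)%:R] y)).
  apply: eq_bigr => y _; rewrite erropE /stab_avg ffunE sum_ffunE /GRing.scale /=.
  rewrite mulrCA mulr_sumr; congr (_ * _); apply: eq_bigr => t _.
  by rewrite -erropE errop_stab ffunE.
rewrite -mulr_sumr; congr (_ * _).
rewrite exchange_big [RHS]big_mkcond; apply: eq_bigr => t _.
by rewrite -mulr_sumr errop_trace; case: ifP; rewrite ?mulr0.
Qed.

Lemma trace_stab_avg :
  \sum_(y : qword p N) stab_avg [ffun u => (u == y)%:R] y = (\dim stab_code)%:R.
Proof.
rewrite /stab_code dim_limg_idem => [|v]; first by under [RHS]eq_bigr do rewrite lfunE.
rewrite [LHS]lfunE /= /stab_avg (eq_bigr (fun=> linfun stab_avg v)) => [|t _].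
  by rewrite sumr_const -scaler_nat scalerA mulVf ?card_V_neq0 ?scale1r.
by apply/stab_codeP; rewrite memv_img ?memvf.
Qed.

(** The dimension is the trace of the projector. By injectivity [t = 0] alone contributes, which
    gives p^N / p^r. *)
Lemma dim_stab_code : \dim stab_code = (p ^ (N - r))%N.
Proof.
apply/eqP; rewrite -(eqr_nat algC) -trace_stab_avg.
under eq_bigr do rewrite -[stab_avg _]errop00.
rewrite errop_stab_avg_trace (big_pred1 0) => [|t]; last first.
  rewrite !add0r; apply/andP/eqP => [[/eqP at0 /eqP bt0]|->]; first exact: ab_inj.
  by rewrite (additive0 aD) (additive0 bD) !eqxx.
rewrite /phase (additive0 aD) (additive0 bD) !dot0l mul0r addr0 chi0 mul1r cardV.
rewrite natrX [X in _ * X]natrX -[in X in _ * X](subnK le_rN).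
by rewrite exprD mulrC mulfK ?natrX // expf_neq0 // pnatr_eq0; case: p p_pr.
Qed.

(** The isometry [stab t] fixes the code, and moving it past the error multiplies the matrix element
    by a character value different from 1. *)
Lemma braket_errop_eq0 (x z : qword p N) t :
    dot (b t) x != dot (a t) z ->
  forall v1 v2, v1 \in stab_code -> v2 \in stab_code -> braket v1 (errop x z v2) = 0.
Proof.
move=> neq v1 v2 /stab_codeP fix1 /stab_codeP fix2.
have /eqP := braket_stab t v1 (errop x z v2).
rewrite fix1 stab_errop braketZr fix2 -subr_eq0 -{2}[braket _ _]mul1r -mulrBl.
by rewrite mulf_eq0 subr_eq0 chi_eq1 // subr_eq0 (negbTE neq) => /eqP.
Qed.

(* An error commuting with every stabilizer element preserves the code, so if detectable it is
   a scalar there; comparing traces, that scalar is 0 unless the error is itself a stabilizer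
   element. *)
Lemma not_detectable_stab_code (x z : qword p N) :
    (forall t, dot (b t) x = dot (a t) z) ->
    (forall t, x = a t -> z <> b t) ->
  ~ detectable stab_code x z.
Proof.
move=> comm notin [c det].
have errop_in v : v \in stab_code -> errop x z v \in stab_code.
  move=> /stab_codeP fixv; apply/stab_codeP => t.
  by rewrite stab_errop comm subrr chi0 scale1r fixv.
have errop_scal v : v \in stab_code -> errop x z v = c *: v.
  move=> vQ; apply/eqP; rewrite -subr_eq0; apply/eqP/braket_eq0.
  have dQ : errop x z v - c *: v \in stab_code by rewrite rpredB ?rpredZ ?errop_in.
  by rewrite braketBr braketZr det ?subrr.
have c0 : c = 0.
  have trP : \sum_(y : qword p N) stab_avg [ffun u => (u == y)%:R] y != 0.
    by rewrite trace_stab_avg dim_stab_code pnatr_eq0 expn_eq0; case: p p_pr.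
  have := errop_stab_avg_trace x z.
  rewrite [X in _ * X]big_pred0 ?mulr0 => [|t]; last first.
    apply/negP => /andP[]; rewrite !addr_eq0 => /eqP xa /eqP zb.
    apply: (notin (- t)); [rewrite xa|rewrite zb]; symmetry; apply/eqP.
      by rewrite -addr_eq0 -aD addNr (additive0 aD).
    by rewrite -addr_eq0 -bD addNr (additive0 bD).
  rewrite (eq_bigr (fun y => c * stab_avg [ffun u => (u == y)%:R] y)) => [|y _]; last first.
    by rewrite errop_scal ?ffunE //; apply/stab_codeP => t; exact: stab_stab_avg.
  by rewrite -mulr_sumr => /eqP; rewrite mulf_eq0 (negbTE trP) orbF => /eqP.
(* An error operator is injective, so acting as 0 would force the code to be trivial, against its
   dimension. *)
have dim_neq0 : \dim stab_code != 0%N by rewrite dim_stab_code expn_eq0; case: p p_pr.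
case/negP: dim_neq0; rewrite dimv_eq0 -subv0; apply/subvP => v vQ.
rewrite memv0; apply/eqP; have := errop_scal v vQ; rewrite c0 scale0r => /ffunP ev0.
apply/ffunP => y; rewrite ffunE; have /eqP := ev0 (y + x); rewrite erropE addrK ffunE mulf_eq0.
case/orP => [/eqP chi0|/eqP //].
by have := chi_unit p_pr (dot z y); rewrite chi0 mulr0 => /esym/eqP; rewrite oner_eq0.
Qed.
End Stabilizer.

(** * Codes from point sets *)

HB.instance Definition _ (U V : finZmodType) := GRing.Zmodule.on (U * V)%type.

Section PointSet.
Variables (p n : nat) (A : 'M['F_p]_n) (S : {set 'rV['F_p]_n}).
Hypotheses (p_pr : prime p) (p_odd : odd p).
Hypothesis A_noeig : forall (x : 'rV_n) (c : 'F_p), x *m A = c *: x -> x = 0.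
Hypothesis S_moment0 : #|S|%:R = 0 :> 'F_p.
Hypothesis S_moment1 : \sum_(x in S) x = 0.
Hypothesis S_moment2 : \sum_(x in S) x^T *m x = 0.
Hypothesis S_span : forall (y : 'cV_n) (c d : 'F_p),
  (forall x, x \in S -> (x *m y) 0 0 = c) ->
  (forall x, x \in S -> (x *m A *m y) 0 0 = d) -> y = 0.
Hypothesis le_S : (n + 2 <= #|S|)%N.

Let V : finZmodType := ('F_p * 'F_p * 'cV['F_p]_n)%type.
Let N := #|S|.

(** A triple [t] is a linear form on F_p^(n+2); [Xrow t] and [Zrow t] list its values on a_x = (1,
    0, x) and b_x = (0, 1, x A) over the points x of [S]. *)
Definition Xrow (t : V) : qword p N := [ffun i => t.1.1 + (enum_val i *m t.2) 0 0].
Definition Zrow (t : V) : qword p N := [ffun i => t.1.2 + (enum_val i *m A *m t.2) 0 0].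

Lemma XrowD s t : Xrow (s + t) = Xrow s + Xrow t.
Proof. by apply/ffunP => i; rewrite !ffunE mulmxDr mxE addrACA. Qed.

Lemma ZrowD s t : Zrow (s + t) = Zrow s + Zrow t.
Proof. by apply/ffunP => i; rewrite !ffunE mulmxDr mxE addrACA. Qed.

(** Each summand is a polynomial of degree at most 2 in the point, so the sum is a combination of
    the vanishing moments. *)
Lemma Xrow_Zrow s t : dot (Xrow s) (Zrow t) = 0.
Proof.
transitivity (\sum_(x in S) (s.1.1 + (x *m s.2) 0 0) * (t.1.2 + (x *m A *m t.2) 0 0)).
  by rewrite [RHS]big_enum_val; apply: eq_bigr => i _; rewrite !ffunE.
transitivity (\sum_(x in S) (s.1.1 * t.1.2 + s.1.1 * (x *m A *m t.2) 0 0
   + t.1.2 * (x *m s.2) 0 0 + (s.2^T *m (x^T *m x) *m A *m t.2) 0 0)).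
  apply: eq_bigr => x _.
  have -> : (s.2^T *m (x^T *m x) *m A *m t.2) 0 0 = (x *m s.2) 0 0 * (x *m A *m t.2) 0 0.
    by rewrite mulmxA -trmx_mul -!mulmxA mxE big_ord1 mxE !mulmxA.
  ring.
have sum_lin m (B : 'M_(n, m)) i : \sum_(x in S) (x *m B) 0 i = 0.
  by rewrite -summxE -mulmx_suml S_moment1 mul0mx mxE.
have sum_linA : \sum_(x in S) (x *m A *m t.2) 0 0 = 0.
  by under eq_bigr do rewrite -mulmxA; exact: sum_lin.
rewrite !big_split /= sumr_const -!mulr_sumr sum_linA sum_lin -mulr_natr S_moment0.
by rewrite -summxE -!mulmx_suml -mulmx_sumr S_moment2 mulmx0 !mul0mx mxE !mulr0 !addr0.
Qed.

Lemma row_inj t : Xrow t = 0 -> Zrow t = 0 -> t = 0.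
Proof.
move=> /ffunP X0 /ffunP Z0.
have Xt x : x \in S -> t.1.1 + (x *m t.2) 0 0 = 0.
  by move=> xS; have := X0 (enum_rank_in xS x); rewrite !ffunE enum_rankK_in.
have Zt x : x \in S -> t.1.2 + (x *m A *m t.2) 0 0 = 0.
  by move=> xS; have := Z0 (enum_rank_in xS x); rewrite !ffunE enum_rankK_in.
have y0 : t.2 = 0.
  apply: (@S_span _ (- t.1.1) (- t.1.2)) => x xS; apply/eqP.
    by rewrite -addr_eq0 addrC Xt.
  by rewrite -addr_eq0 addrC Zt.
have [x xS] : exists x, x \in S by apply/card_gt0P; apply: leq_trans le_S; rewrite addnS.
move: (Xt x xS) (Zt x xS); rewrite y0 !mulmx0 mxE !addr0.
by case: t y0 {X0 Z0 Xt Zt} => [[al be] y] /= -> -> ->.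
Qed.

Lemma card_param : #|V| = (p ^ (n + 2))%N.
Proof. by rewrite !card_prod card_mx !card_Fp // muln1 addn2 !expnSr mulnC mulnA mulnC. Qed.

Definition point_code : {vspace qstate p N} := stab_code Xrow Zrow.

Lemma row_isotropic s t : dot (Xrow s) (Zrow t) = dot (Xrow t) (Zrow s).
Proof. by rewrite !Xrow_Zrow. Qed.

(** Contrapositive: an error commuting with all stabilizers is a linear relation among the vectors
    a_x and b_x. If it involves at most two points, with difference d, it reduces to x_i d A = z_i
    d, and the absence of eigenvalues forces x_i = z_i = 0. *)
Lemma point_code_pure (x z : qword p N) :
    (1 <= qweight x z <= 2)%N ->
  forall v1 v2, v1 \in point_code -> v2 \in point_code -> braket v1 (errop x z v2) = 0.
Proof.
move=> wt; suff [t xzt] : exists t, dot (Zrow t) x != dot (Xrow t) z.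
  exact: (braket_errop_eq0 p_pr p_odd XrowD ZrowD row_isotropic card_param xzt).
apply/existsP; apply: contraLR wt; rewrite negb_exists => /forallP comm.
have {}comm t : dot (Zrow t) x = dot (Xrow t) z by have := comm t; rewrite negbK => /eqP.
have sumx : \sum_i x i = 0.
  have := comm ((0, 1), 0).
  rewrite /dot [RHS]big1 => [e|i _]; last by rewrite ffunE mulmx0 mxE addr0 mul0r.
  by rewrite -[RHS]e; apply: eq_bigr => i _; rewrite ffunE mulmx0 mxE addr0 mul1r.
have sumz : \sum_i z i = 0.
  have := comm ((1, 0), 0).
  rewrite /dot [LHS]big1 => [e|i _]; last by rewrite ffunE mulmx0 mxE addr0 mul0r.
  by rewrite [RHS]e; apply: eq_bigr => i _; rewrite ffunE mulmx0 mxE addr0 mul1r.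
have sum_pt : \sum_i x i *: (enum_val i *m A) = \sum_i z i *: enum_val i.
  apply/rowP => j; have := comm ((0, 0), delta_mx j 0).
  rewrite /dot !summxE => eq_j; transitivity (\sum_i Zrow ((0, 0), delta_mx j 0) i * x i).
    by apply: eq_bigr => i _; rewrite ffunE /= add0r -colE !mxE mulrC.
  by rewrite eq_j; apply: eq_bigr => i _; rewrite ffunE /= add0r -colE !mxE mulrC.
set W := [set i | (x i != 0) || (z i != 0)]; rewrite /qweight -/W.
suff contra i j : i \in W -> W \subset [set i; j] -> False.
  apply/negP => /andP[/card_gt0P[i iW] W_le2].
  have W_le1 : (#|W :\ i| <= 1)%N by move: W_le2; rewrite (cardsD1 i) iW.
  have [j jP] : exists j, W :\ i \subset [set j].
    (* When the support is the single index [i], the second index is taken equal to [i]. *)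
    case: (set_0Vmem (W :\ i)) => [->|[j jW]]; first by exists i; rewrite sub0set.
    exists j; apply/subsetP => k kW; rewrite inE; apply/eqP.
    by move/card_le1_eqP: W_le1; apply.
  by apply: (contra i j iW); rewrite -subDset setDE -setDE.
move=> iW WS.
have off k : k != i -> k != j -> x k = 0 /\ z k = 0.
  move=> kNi kNj; have : k \notin W.
    by apply: contra (subsetP WS k) _; rewrite !inE negb_or kNi.
  by rewrite inE => /norP[/negPn/eqP ? /negPn/eqP ?].
(* As [x] and [z] have sum 0, the origin can be moved to the point of index [j], which eliminates
   that index. *)
have shift : \sum_k x k *: ((enum_val k - enum_val j) *m A) =
    \sum_k z k *: (enum_val k - enum_val j).
  under eq_bigr do rewrite mulmxBl scalerBr; under [RHS]eq_bigr do rewrite scalerBr.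
  by rewrite !sumrB -!scaler_suml sumx sumz !scale0r sum_pt.
have sum_i (M : lmodType 'F_p) (c : qword p N) (g : 'I_N -> M) :
    (forall k, k != i -> k != j -> c k = 0) -> g j = 0 -> \sum_k c k *: g k = c i *: g i.
  move=> c0 gj0; rewrite (bigD1 i) //= big1 ?addr0 // => k kNi.
  by have [->|kNj] := eqVneq k j; rewrite ?gj0 ?scaler0 // c0 ?scale0r.
have [ij|iNj] := eqVneq i j.
  have sum0 (c : qword p N) : (forall k, k != i -> k != j -> c k = 0) -> \sum_k c k = c i.
    by move=> c0; rewrite (bigD1 i) //= big1 ?addr0 // => k kNi; rewrite c0 // -ij.
  move: iW; rewrite inE -!sum0 ?sumx ?sumz ?eqxx // => k ki kj; by case: (off k ki kj).
have eq_i : x i *: ((enum_val i - enum_val j) *m A) = z i *: (enum_val i - enum_val j).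
  rewrite -(sum_i _ x (fun k => (enum_val k - enum_val j) *m A)) ?subrr ?mul0mx //.
    rewrite shift; apply: sum_i; rewrite ?subrr // => k ki kj; by case: (off k ki kj).
  by move=> k ki kj; case: (off k ki kj).
have d_neq0 : enum_val i - enum_val j != 0.
  by rewrite subr_eq0; apply: contraNneq iNj => /enum_val_inj ->.
have xi0 : x i = 0.
  apply: contraNeq d_neq0 => xi_neq0; apply/eqP.
  apply: (@A_noeig _ ((x i)^-1 * z i)).
  by rewrite -scalerA -eq_i scalerA mulVf ?scale1r.
move: iW; rewrite inE xi0 eqxx /=; apply/negP/negPn.
by have /eqP := eq_i; rewrite xi0 scale0r eq_sym scaler_eq0 (negbTE d_neq0) orbF.
Qed.

Definition second_difference (x0 dx x : 'rV['F_p]_n) : 'F_p :=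
  (x == x0)%:R - 2%:R * (x == x0 + dx)%:R + (x == x0 + dx + dx)%:R.

Lemma progression_neq (x0 dx : 'rV['F_p]_n) : dx != 0 ->
  [/\ (x0 == x0 + dx) = false, (x0 == x0 + dx + dx) = false &
      (x0 + dx == x0 + dx + dx) = false].
Proof.
have addr_eq (x d : 'rV['F_p]_n) : d != 0 -> (x == x + d) = false.
  by move=> d_neq0; rewrite -subr_eq0 opprD addrA subrr add0r oppr_eq0 (negbTE d_neq0).
move=> dx_neq0; split; [exact: addr_eq| |exact: addr_eq].
rewrite -addrA addr_eq // -mulr2n -scaler_nat.
by rewrite scaler_eq0 (negbTE dx_neq0) (negbTE (two_unit p_pr p_odd)).
Qed.

Hypothesis S_diff : exists x0 dx : 'rV['F_p]_n,
  [/\ dx != 0, x0 \in S, x0 + dx \in S, x0 + dx + dx \in S &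
      forall (c : 'F_p) (y : 'cV_n),
        ~ (forall x, x \in S -> c + (x *m y) 0 0 = second_difference x0 dx x)].

(** The pure shift by a second difference commutes with every stabilizer because affine functions
    have zero second difference along a progression; [S_diff] ensures that it is not itself a row
    [Xrow t]. *)
Lemma point_code_distance :
  exists x z : qword p N, qweight x z = 3 /\ ~ detectable point_code x z.
Proof.
have [x0 [dx [dx_neq0 x0S x1S x2S ndiff]]] := S_diff.
have [x01 x02 x12] := progression_neq x0 dx_neq0.
exists [ffun i => second_difference x0 dx (enum_val i)], 0; split.
  rewrite /qweight -sum1_card.
  rewrite (eq_bigl (fun i => second_difference x0 dx (enum_val i) != 0)); last first.
    by move=> i; rewrite !inE !ffunE eqxx orbF.
  rewrite -(big_enum_val_cond (fun x => second_difference x0 dx x != 0) (fun=> 1%N)).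
  rewrite (eq_bigl (mem (x0 |: [set x0 + dx; x0 + dx + dx]))) => [|x].
    rewrite sum1_card cardsU1 cards2 !inE x01 x02 x12 //.
  rewrite !inE /second_difference; have [->|xNx0] := eqVneq x x0.
    by rewrite x0S x01 x02 mulr0 subr0 addr0 oner_eq0.
  have [->|xNx1] := eqVneq x (x0 + dx).
    by rewrite x1S x12 addr0 mulr1 sub0r oppr_eq0 two_unit.
  have [->|xNx2] := eqVneq x (x0 + dx + dx); first by rewrite x2S mulr0 subr0 add0r oner_eq0.
  by rewrite mulr0 subr0 addr0 eqxx andbF.
apply: (not_detectable_stab_code p_pr p_odd XrowD ZrowD row_isotropic row_inj card_param le_S) => t.
  rewrite [RHS]dotC dot0l.
  transitivity (\sum_(x in S) (t.1.2 + (x *m A *m t.2) 0 0) * second_difference x0 dx x).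
    by rewrite [RHS]big_enum_val; apply: eq_bigr => i _; rewrite !ffunE.
  have sum_at (h : 'rV_n -> 'F_p) x1 : x1 \in S -> \sum_(x in S) h x * (x == x1)%:R = h x1.
    move=> x1S'; rewrite (bigD1 x1) //= eqxx mulr1 big1 ?addr0 // => x /andP[_ /negbTE ->].
    by rewrite mulr0.
  rewrite /second_difference; under eq_bigr do rewrite mulrDr mulrBr mulrCA.
  rewrite big_split /= sumrB -mulr_sumr !sum_at //.
  have lD (u v : 'rV_n) : ((u + v) *m A *m t.2) 0 0 = (u *m A *m t.2) 0 0 + (v *m A *m t.2) 0 0.
    by rewrite !mulmxDl [LHS]mxE.
  have alg (R : comNzRingType) (c u v : R) :
      c + u - 2%:R * (c + (u + v)) + (c + (u + v + v)) = 0 by ring.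
  rewrite (lD (x0 + dx) dx) (lD x0 dx); exact: alg.
move=> eqX _; apply: (ndiff t.1.1 t.2) => x xS.
move/ffunP/(_ (enum_rank_in xS x)): eqX; by rewrite !ffunE enum_rankK_in.
Qed.

Lemma point_code_correct :
  is_qcode (#|S| - (n + 2)) 3 point_code /\ is_pure 3 point_code.
Proof.
split; last by move=> x z /point_code_pure.
split; last exact: point_code_distance.
  exact: (dim_stab_code p_pr p_odd XrowD ZrowD row_isotropic row_inj card_param le_S).
move=> x z wt; have [wt0|wt_gt0] := posnP (qweight x z).
  exists 1 => v1 v2 _ _; rewrite mul1r; congr braket.
  suff [-> ->] : x = 0 /\ z = 0 by exact: errop00.
  move/eqP: wt0; rewrite cards_eq0 => /eqP/setP W0.
  by split; apply/ffunP => i; have := W0 i; rewrite !inE ffunE => /norP[/negPn/eqP ? /negPn/eqP ?].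
exists 0 => v1 v2 v1Q v2Q; rewrite mul0r point_code_pure //.
by rewrite wt_gt0.
Qed.
End PointSet.

(** * Companion matrices and moments *)

(** The map takes the value 0 at both 0 and 1, so it is not injective, hence not surjective on a
    finite field. *)
Lemma Xn_subX_not_onto (F : finFieldType) n :
  exists d : F, forall x : F, x ^+ n.+1 - x != d.
Proof.
pose f (x : F) := x ^+ n.+1 - x.
have [/forallP onto|] := boolP [forall d, d \in codom f]; last first.
  rewrite negb_forall => /existsP[d dNf]; exists d => x.
  by apply: contraNneq dNf => <-; exact: codom_f.
have /image_injP f_inj : #|codom f| == #|F| by apply/eqP/eq_card => d; rewrite onto.
have : (0 : F) = 1.
  by apply: f_inj; rewrite // /f expr1n expr0n /= !subrr.
by move/eqP; rewrite eq_sym oner_eq0.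
Qed.

Section Companion.
Variables (F : fieldType) (m : nat) (d : F).

(** Companion matrix of T^(m+3) - T - d acting on row vectors: a shift, with last row (d, 1, 0, ...,
    0). *)
Definition companion : 'M[F]_m.+3 :=
  \matrix_(i, j) ((i.+1 == j)%:R + (i == ord_max)%:R * (d * (j == 0)%:R + (j == 1)%:R)).

(** The eigenvector equation makes every coordinate a multiple of the last one, and the equation
    left over reads (c^(m+3) - c - d) times the last coordinate = 0. *)
Lemma companion_noeig (x : 'rV_m.+3) c :
  (forall e, e ^+ m.+3 - e != d) -> x *m companion = c *: x -> x = 0.
Proof.
move=> d_val xA.
pose X k := x 0 (inord k).
have xE i : x 0 i = X i by rewrite /X inord_val.
have xAE (j : 'I_m.+3) : c * X j =
    (if (j == 0 :> nat)%N then 0 else X j.-1) + X m.+2 * (d * (j == 0)%:R + (j == 1)%:R).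
  have := congr1 (fun M : 'rV_m.+3 => M 0 j) xA; rewrite !mxE -xE => <-.
  under eq_bigr do rewrite mxE mulrDr mulrA.
  rewrite big_split /=; congr (_ + _).
    case: posnP => [j0|j_gt0].
      by rewrite big1 // => i _; rewrite j0 mulr0.
    rewrite (bigD1 (inord j.-1)) //= inordK; last by have := ltn_ord j; lia.
    rewrite prednK // eqxx mulr1 big1 ?addr0 // => i.
    rewrite -val_eqE /= inordK; last by have := ltn_ord j; lia.
    by move=> iNj; case: eqP => [ij|]; rewrite ?mulr0 //; move: iNj; rewrite -ij eqxx.
  rewrite (bigD1 ord_max) //= eqxx mulr1 big1 ?addr0 => [|i /negbTE ->].
    by rewrite xE.
  by rewrite mulr0 mul0r.
have e0 : c * X 0%N = X m.+2 * d by have := xAE 0; rewrite /= mulr1 addr0 add0r.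
have e1 : c * X 1%N = X 0%N + X m.+2 by have := xAE 1; rewrite /= modn_small // mulr0 add0r mulr1.
have eS k : (0 < k < m.+2)%N -> X k = c * X k.+1.
  move=> /andP[k_gt0 lt_k]; have := xAE (inord k.+1); rewrite inordK; last by lia.
  move=> ->; rewrite /= -!val_eqE /= inordK; last by lia.
  by rewrite !(modn_small _) //; case: k k_gt0 {lt_k} => //= k _; rewrite !mulr0 addr0 mulr0 addr0.
have eX k : (k < m.+2)%N -> X (m.+2 - k)%N = c ^+ k * X m.+2.
  elim: k => [|k IHk] lt_k; first by rewrite mul1r subn0.
  rewrite eS; last by lia.
  rewrite (_ : (m.+2 - k.+1).+1 = m.+2 - k)%N; last by lia.
  by rewrite IHk ?exprS ?mulrA // ltnW.
have X1 : X 1%N = c ^+ m.+1 * X m.+2 by rewrite -eX // subSn // subnn.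
have X0 : X 0%N = c ^+ m.+2 * X m.+2 - X m.+2 by rewrite exprS -mulrA -X1 e1 addrK.
have Xl : X m.+2 = 0.
  have : (c ^+ m.+3 - c - d) * X m.+2 = 0.
    by rewrite !mulrBl exprS -mulrA [d * _]mulrC -e0 X0; ring.
  by move/eqP; rewrite mulf_eq0 subr_eq0 (negbTE (d_val c)) => /eqP.
apply/rowP => i; rewrite xE mxE.
have [->|i_gt0] := posnP i; first by rewrite X0 Xl mulr0 subr0.
have -> : (i : nat) = (m.+2 - (m.+2 - i))%N by have := ltn_ord i; lia.
by rewrite eX ?Xl ?mulr0 //; lia.
Qed.

Lemma companion_mulE (y : 'cV_m.+3) (i j : 'I_m.+3) :
  j = i.+1 :> nat -> (companion *m y) i 0 = y j 0.
Proof.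
move=> ji; rewrite mxE (bigD1 j) //= mxE ji eqxx.
have iNm : (i == ord_max) = false by rewrite -val_eqE /=; have := ltn_ord j; lia.
rewrite iNm mul0r addr0 mul1r big1 ?addr0 // => k kNj.
rewrite mxE iNm mul0r addr0 -ji; case: eqP => [jk|]; last by rewrite mul0r.
by move: kNj; rewrite -val_eqE /= jk eqxx.
Qed.

End Companion.

(** An injection of a finite set into itself permutes it. *)
Lemma sum_stable (R : nmodType) (T : finType) (S : {set T}) (h : T -> T) (F : T -> R) :
    injective h -> (forall x, x \in S -> h x \in S) ->
  \sum_(x in S) F (h x) = \sum_(x in S) F x.
Proof.
move=> h_inj hS; have im_h : h @: S = S.
  apply/eqP; rewrite eqEcard card_imset // leqnn andbT.
  by apply/subsetP => _ /imsetP[x xS ->]; exact: hS.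
by rewrite -[in RHS]im_h big_imset //= => x y _ _; exact: h_inj.
Qed.

(** * Moments of unions of lines parallel to a coordinate axis *)

Section Moments.
Variables (p n : nat).
Hypotheses (p_pr : prime p) (p_odd : odd p).
Implicit Types (S : {set 'rV['F_p]_n}) (i j k l : 'I_n).

Definition free_coord S k :=
  forall x c, x \in S -> x + c *: delta_mx 0 k \in S.

Let M S i j := \sum_(x in S) x 0 i * x 0 j.

Lemma shearE (x : 'rV['F_p]_n) c k i : (x + c *: delta_mx 0 k) 0 i = x 0 i + c * (i == k)%:R.
Proof. by rewrite !mxE eqxx. Qed.

(** Translations, shears and the doubling of coordinate [k] all permute such a set. Comparing a sum
    before and after each map yields the vanishing of the moments. *)
Lemma translate_moment S k (g : 'rV['F_p]_n -> 'F_p) : free_coord S k ->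
  \sum_(x in S) g (x + delta_mx 0 k) = \sum_(x in S) g x.
Proof.
move=> Sk; apply: sum_stable => [|x xS]; first exact: addIr.
by rewrite -[delta_mx _ _]scale1r Sk.
Qed.

(** The shear adds x_i to x_k and keeps x_i, hence is injective. *)
Lemma shear_moment S k i (g : 'rV['F_p]_n -> 'F_p) : free_coord S k -> i != k ->
  \sum_(x in S) g (x + x 0 i *: delta_mx 0 k) = \sum_(x in S) g x.
Proof.
move=> Sk iNk; apply: sum_stable => [x y exy|x xS]; last exact: Sk.
have := congr1 (fun z : 'rV_n => z 0 i) exy.
rewrite !shearE (negbTE iNk) !mulr0 !addr0 => exyi.
by move: exy; rewrite exyi => /addIr.
Qed.

Lemma double_inj : injective (fun u : 'F_p => u + u).
Proof.
move=> u v /eqP; rewrite -!mulr2n -subr_eq0 -mulrnBl -mulr_natl mulf_eq0.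
by rewrite (negbTE (two_unit p_pr p_odd)) subr_eq0 => /eqP.
Qed.

Lemma double_moment S k (g : 'rV['F_p]_n -> 'F_p) : free_coord S k ->
  \sum_(x in S) g (x + x 0 k *: delta_mx 0 k) = \sum_(x in S) g x.
Proof.
move=> Sk; apply: sum_stable => [x y exy|x xS]; last exact: Sk.
have := congr1 (fun z : 'rV_n => z 0 k) exy.
rewrite !shearE eqxx !mulr1 => /double_inj exyk.
by move: exy; rewrite exyk => /addIr.
Qed.

Lemma free_card S k : free_coord S k -> #|S|%:R = 0 :> 'F_p.
Proof.
move=> Sk; have := translate_moment (fun x => x 0 k) Sk.
under eq_bigr do rewrite -[delta_mx _ _]scale1r shearE eqxx mulr1.
rewrite big_split /= -[RHS]addr0 => /addrI.
by rewrite sumr_const.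
Qed.

(** Translation changes the sum of x_i x_k by the sum of x_i if i differs from k, and by twice the
    sum of x_k plus [#|S|] if i = k. *)
Lemma free_moment1 S k i : free_coord S k -> \sum_(x in S) x 0 i = 0.
Proof.
move=> Sk; have := translate_moment (fun x => x 0 i * x 0 k) Sk.
under eq_bigr do rewrite -[delta_mx _ _]scale1r !shearE eqxx !mul1r.
have [->|iNk] := eqVneq i k.
  under eq_bigr do rewrite mulrDr mulrDl mulrDl !mul1r !mulr1 -addrA.
  rewrite big_split /= -[RHS]addr0 => /addrI; rewrite !big_split /= sumr_const.
  rewrite (free_card Sk) addr0 -mulr2n -mulr_natl => /eqP.
  by rewrite mulf_eq0 (negbTE (two_unit p_pr p_odd)) => /eqP.
under eq_bigr do rewrite addr0 mulrDr mulr1.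
by rewrite big_split /= -[RHS]addr0 => /addrI.
Qed.

Lemma free_moment2_off S k i j : free_coord S k -> i != k -> j != k -> M S i j = 0.
Proof.
move=> Sk iNk jNk; have := shear_moment (fun x => x 0 k * x 0 j) Sk iNk.
under eq_bigr do rewrite !shearE eqxx (negbTE jNk) mulr0 mulr1 addr0 mulrDl.
by rewrite big_split /= -[RHS]addr0 => /addrI.
Qed.

(** The shear changes the sum of x_k^2 by twice the sum of x_i x_k plus the sum of x_i^2, and the
    latter is already 0. *)
Lemma free_moment2_row S k i : free_coord S k -> i != k -> M S i k = 0.
Proof.
move=> Sk iNk; have := shear_moment (fun x => x 0 k * x 0 k) Sk iNk.
under eq_bigr => x _ do
  rewrite !shearE eqxx !mulr1 mulrDr mulrDl mulrDl -addrA [x 0 k * x 0 i]mulrC.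
rewrite big_split /= -[RHS]addr0 => /addrI; rewrite !big_split /= -!/(M _ _ _).
rewrite (free_moment2_off Sk iNk iNk) addr0 -mulr2n -mulr_natl => /eqP.
by rewrite mulf_eq0 (negbTE (two_unit p_pr p_odd)) => /eqP.
Qed.

Lemma free_moment2_diag S k : free_coord S k ->
  p != 3 \/ (exists2 l : 'I_n, l != k & free_coord S l) -> M S k k = 0.
Proof.
move=> Sk [p_neq3|[l lNk Sl]]; last by apply: (free_moment2_off Sl); rewrite eq_sym.
(* Doubling x_k multiplies the moment by 4, so 3 times the moment is 0. *)
have := double_moment (fun x => x 0 k * x 0 k) Sk.
under eq_bigr do rewrite !shearE eqxx mulr1 mulrDr mulrDl -addrA.
rewrite big_split /= -[RHS]addr0 => /addrI; rewrite !big_split /= -!/(M _ _ _).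
rewrite -mulr2n -mulrS -mulr_natl => /eqP.
by rewrite mulf_eq0 (negbTE (three_unit p_pr p_neq3)) => /eqP.
Qed.

Lemma free_moment2 S k : free_coord S k ->
  p != 3 \/ (exists2 l : 'I_n, l != k & free_coord S l) -> \sum_(x in S) x^T *m x = 0.
Proof.
move=> Sk dk; apply/matrixP => i j; rewrite summxE mxE.
transitivity (M S i j).
  by apply: eq_bigr => x _; rewrite mxE big_ord1 mxE.
have MC a b : M S a b = M S b a by apply: eq_bigr => x _; rewrite mulrC.
have [->|iNk] := eqVneq i k; have [->|jNk] := eqVneq j k.
- exact: free_moment2_diag.
- by rewrite MC (free_moment2_row Sk).
- exact: free_moment2_row.
- exact: free_moment2_off Sk _ _.
Qed.

(** If p is not 3, the values 1, -2, 1 on the progression have second difference 6, which is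
    nonzero, so no affine function takes them. For p = 3 these values are constant, and the second
    free direction [l] serves instead: along it the values are 1, 0, 0, with second difference 1. *)
Lemma free_second_difference S k : free_coord S k ->
    p != 3 \/ (exists2 l : 'I_n, l != k & free_coord S l) -> (0 < #|S|)%N ->
  exists x0 dx : 'rV['F_p]_n,
  [/\ dx != 0, x0 \in S, x0 + dx \in S, x0 + dx + dx \in S &
      forall (c : 'F_p) (y : 'cV_n),
        ~ (forall x, x \in S -> c + (x *m y) 0 0 = second_difference x0 dx x)].
Proof.
move=> Sk dk /card_gt0P[x0 x0S]; exists x0, (delta_mx 0 k).
have delta_neq0 i : delta_mx 0 i != 0 :> 'rV['F_p]_n.
  by apply/eqP => /rowP/(_ i)/eqP; rewrite !mxE !eqxx oner_eq0.
have free1 i x : free_coord S i -> x \in S -> x + delta_mx 0 i \in S.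
  by move=> Si xS; rewrite -[delta_mx _ _]scale1r Si.
split; rewrite ?free1 // => c y affine.
have addE (u v : 'rV['F_p]_n) : ((u + v) *m y) 0 0 = (u *m y) 0 0 + (v *m y) 0 0.
  by rewrite mulmxDl mxE.
have [x01 x02 x12] := progression_neq p_pr p_odd x0 (delta_neq0 k).
case: dk => [p_neq3|[l lNk Sl]].
  have A0 := affine x0 x0S; have A1 := affine _ (free1 _ _ Sk x0S).
  have A2 := affine _ (free1 _ _ Sk (free1 _ _ Sk x0S)).
  move: A0 A1 A2; rewrite /second_difference !eqxx x01 x02 x12 ![_ == x0]eq_sym x01 x02.
  rewrite [_ == x0 + _]eq_sym x12 !addE /=.
  have alg (R : comNzRingType) (a u v : R) : a + u = 1 - 2%:R * 0 + 0 ->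
    a + (u + v) = 0 - 2%:R * 1 + 0 -> a + (u + v + v) = 0 - 2%:R * 0 + 1 -> 2%:R * 3%:R = 0 :> R.
    move=> e0 e1 e2.
    transitivity ((a + u) - 2%:R * (a + (u + v)) + (a + (u + v + v))); last by ring.
    by rewrite e0 e1 e2; ring.
  move=> A0 A1 A2; have /eqP := alg _ _ _ _ A0 A1 A2.
  by rewrite mulf_eq0 (negbTE (two_unit p_pr p_odd)) (negbTE (three_unit p_pr p_neq3)).
have sd_off (x : 'rV_n) : x 0 l != x0 0 l -> second_difference x0 (delta_mx 0 k) x = 0.
  move=> xl; have off (z : 'rV_n) : z 0 l = x0 0 l -> (x == z) = false.
    by move=> zl; apply: contraNF xl => /eqP ->; rewrite zl.
  rewrite /second_difference !off ?mulr0 ?subr0 ?addr0 //;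
  by rewrite !mxE (negbTE lNk) ?andbF !addr0.
have A0 := affine x0 x0S; have A1 := affine _ (free1 _ _ Sl x0S).
have A2 := affine _ (free1 _ _ Sl (free1 _ _ Sl x0S)).
have one_unit : (1 : 'F_p) != 0 := oner_neq0 _.
have e1 : second_difference x0 (delta_mx 0 k) (x0 + delta_mx 0 l) = 0.
  by rewrite sd_off // !mxE !eqxx -subr_eq0 addrAC subrr add0r.
have e2 : second_difference x0 (delta_mx 0 k) (x0 + delta_mx 0 l + delta_mx 0 l) = 0.
  rewrite sd_off // !mxE !eqxx -addrA -subr_eq0 addrAC subrr add0r -mulr2n.
  exact: two_unit.
have e0 : second_difference x0 (delta_mx 0 k) x0 = 1.
  by rewrite /second_difference eqxx x01 x02 mulr0 subr0 addr0.
move: A0 A1 A2; rewrite e0 e1 e2 !addE.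
have alg (R : comNzRingType) (a u v : R) : a + u = 1 -> a + (u + v) = 0 ->
    a + (u + v + v) = 0 -> 1 = 0 :> R.
  move=> f0 f1 f2; rewrite -f0; transitivity (2%:R * (a + (u + v)) - (a + (u + v + v))).
    by ring.
  by rewrite f1 f2; ring.
by move=> A0 A1 A2; move/eqP: (alg _ _ _ _ A0 A1 A2); rewrite oner_eq0.
Qed.
End Moments.

(** * Cylinders *)

Section Cylinder.
Variables (p m : nat) (T : {set 'F_p * 'F_p}).
(** This is T x F_p^m x {0} in F_p^(m+3): the middle coordinates are free, the last one is fixed. *)
Definition cylinder : {set 'rV['F_p]_m.+3} :=
  [set x : 'rV_m.+3 | ((x 0 0, x 0 1) \in T) && (x 0 ord_max == 0)].

(** At the last index m+2 the value m is out of range for [insub], so the default 0 is the required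
    last coordinate. *)
Definition cylinder_point (u : ('F_p * 'F_p) * 'rV['F_p]_m) : 'rV['F_p]_m.+3 :=
  \row_j (if j == 0 then u.1.1 else if j == 1 then u.1.2
          else if insub (j - 2)%N is Some k then u.2 0 k else 0).

Lemma cylinder_point_max u : cylinder_point u 0 ord_max = 0.
Proof. by rewrite mxE /= insubF // subn2 /= ltnn. Qed.

Lemma cylinder_point_mid u (k : 'I_m) : cylinder_point u 0 (inord k.+2) = u.2 0 k.
Proof.
have lt_k := ltn_ord k.
rewrite mxE -!val_eqE /= inordK; last by lia.
rewrite modn_small //= subn2 insubT /=.
by congr (u.2 0 _); apply: val_inj.
Qed.

Lemma cylinder_point_in a b w : (cylinder_point ((a, b), w) \in cylinder) = ((a, b) \in T).
Proof. by rewrite inE cylinder_point_max !mxE eqxx andbT. Qed.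

Lemma cylinder_pointK (x : 'rV_m.+3) : x 0 ord_max = 0 ->
  cylinder_point ((x 0 0, x 0 1), \row_k x 0 (inord k.+2)) = x.
Proof.
move=> x_max; apply/rowP => j.
have [->|jNmax] := eqVneq j ord_max; first by rewrite cylinder_point_max.
rewrite mxE; have [->//|j_neq0] := eqVneq j 0; have [->//|j_neq1] := eqVneq j 1.
move: jNmax j_neq0 j_neq1; rewrite -!val_eqE /= modn_small // => jm j0 j1.
have lt_j := ltn_ord j; case: insubP => [k _ jk|]; last by lia.
by rewrite mxE; congr (x 0 _); apply: val_inj; move: jk; rewrite /= => jk; rewrite inordK; lia.
Qed.

Lemma cylinder_free_mid (j : 'I_m.+3) : (2 <= j <= m.+1)%N -> free_coord cylinder j.
Proof.
move=> /andP[ge2 le_m] x c; rewrite !inE !shearE.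
have neq (i : 'I_m.+3) : (i != j :> nat)%N -> (i == j) = false by move=> /negbTE; rewrite -val_eqE.
by rewrite !neq ?mulr0 ?addr0 //=; rewrite ?modn_small //; lia.
Qed.

Lemma cylinder_free0 : (forall a a' b, (a, b) \in T -> (a', b) \in T) -> free_coord cylinder 0.
Proof.
move=> T0 x c; rewrite !inE !shearE /= !mulr0 !addr0 => /andP[xT ->].
by rewrite andbT (T0 _ _ _ xT).
Qed.

Hypotheses (p_pr : prime p) (p_odd : odd p).

Lemma card_cylinder : #|cylinder| = (#|T| * p ^ m)%N.
Proof.
have point_inj : injective cylinder_point.
  move=> [[a b] w] [[a' b'] w'] eq_pt.
  have eq_at j := congr1 (fun x : 'rV['F_p]_m.+3 => x 0 j) eq_pt.
  have /= -> : a = a' by have := eq_at 0; rewrite !mxE.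
  have /= -> : b = b' by have := eq_at 1; rewrite !mxE.
  congr (_, _); apply/rowP => k; have := eq_at (inord k.+2).
  by rewrite !cylinder_point_mid.
have -> : cylinder = cylinder_point @: setX T [set: 'rV_m].
  apply/setP => x; apply/idP/imsetP => [|[[[a b] w]]].
    rewrite inE => /andP[xT /eqP xm].
    exists ((x 0 0, x 0 1), \row_k x 0 (inord k.+2)); first by rewrite !inE xT.
    by rewrite cylinder_pointK.
  by rewrite in_setX => /andP[abT _] ->; rewrite cylinder_point_in.
by rewrite card_imset // cardsX cardsT card_mx card_Fp // mul1n.
Qed.

(** One pair of points differing in coordinate [j] alone makes the coefficient at [j] vanish in any
    linear form constant on the set. *)
Definition varies (j : 'I_m.+3) :=
  exists x c, [/\ c != 0, x \in cylinder & x + c *: delta_mx 0 j \in cylinder].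

Hypothesis T_varies0 : exists a a' b, [/\ a != a', (a, b) \in T & (a', b) \in T].
Hypothesis T_varies1 : m = 0%N -> exists a b b', [/\ b != b', (a, b) \in T & (a, b') \in T].

Lemma cylinder_varies0 : varies 0.
Proof.
have [a [a' [b [aa' abT a'bT]]]] := T_varies0.
exists (cylinder_point ((a, b), 0)), (a' - a); split.
- by rewrite subr_eq0 eq_sym.
- by rewrite cylinder_point_in.
rewrite inE !shearE cylinder_point_max !mxE /= !mulr0 !addr0 mulr1.
by rewrite addrC subrK a'bT eqxx.
Qed.

Lemma cylinder_varies1 : m = 0%N -> varies 1.
Proof.
move=> /T_varies1[a [b [b' [bb' abT ab'T]]]].
exists (cylinder_point ((a, b), 0)), (b' - b); split.
- by rewrite subr_eq0 eq_sym.
- by rewrite cylinder_point_in.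
rewrite inE !shearE cylinder_point_max !mxE /= !mulr0 !addr0 mulr1.
by rewrite addrC subrK ab'T eqxx.
Qed.

Lemma cylinder_varies (j : 'I_m.+3) : (2 <= j <= m.+1)%N -> varies j.
Proof.
move=> jP; have [x [_ [_ xS _]]] := cylinder_varies0.
by exists x, 1; split; rewrite ?oner_neq0 ?(cylinder_free_mid jP).
Qed.

Lemma varies_lin j (y : 'cV_m.+3) (c : 'F_p) : varies j ->
  (forall x, x \in cylinder -> (x *m y) 0 0 = c) -> y j 0 = 0.
Proof.
move=> [x [e [e_neq0 xS x'S]]] const_y.
have := const_y _ x'S; rewrite mulmxDl mxE (const_y _ xS) -[RHS]addr0 => /addrI/eqP.
by rewrite -scalemxAl -rowE !mxE mulf_eq0 (negbTE e_neq0) => /eqP.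
Qed.

(* A coordinate of y vanishes if the set varies along it, or, the companion matrix being a
   shift, if the set varies along the preceding one. *)
Lemma cylinder_span (d : 'F_p) (y : 'cV_m.+3) (c c' : 'F_p) :
  (forall x, x \in cylinder -> (x *m y) 0 0 = c) ->
  (forall x, x \in cylinder -> (x *m companion m d *m y) 0 0 = c') -> y = 0.
Proof.
move=> cy cAy.
have y_var j : varies j -> y j 0 = 0 by move/varies_lin; apply; exact: cy.
have y_next (j j' : 'I_m.+3) : varies j -> j' = j.+1 :> nat -> y j' 0 = 0.
  move=> vj jj'; rewrite -(companion_mulE d y jj'); apply: (varies_lin (c := c') vj) => x xS.
  by rewrite mulmxA cAy.
apply/colP => i; rewrite [RHS]mxE; have lt_i := ltn_ord i.
have [i0|i_gt0] := posnP i.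
  by apply: y_var; rewrite (_ : i = 0); [exact: cylinder_varies0|exact: val_inj].
have [i1|i_neq1] := eqVneq (i : nat) 1%N; first exact: (y_next 0 _ cylinder_varies0).
have [le_i|gt_i] := leqP i m.+1; first by apply/y_var/cylinder_varies; lia.
have i_max : i = m.+2 :> nat by lia.
(* The last coordinate is reached from its predecessor m+1, which is coordinate 1 when m = 0;
   [T_varies1] serves that case. *)
have [m0|m_gt0] := posnP m.
  by apply: (y_next 1); [exact: cylinder_varies1 | rewrite i_max m0 /= modn_small].
apply: (y_next (inord m.+1)); last by rewrite i_max inordK.
by apply: cylinder_varies; rewrite inordK //; lia.
Qed.

Lemma cylinder_code k : free_coord cylinder k ->
    p != 3 \/ (exists2 l : 'I_m.+3, l != k & free_coord cylinder l) ->
    (m + 5 <= #|cylinder|)%N ->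
  exists Q : {vspace qstate p #|cylinder|},
    is_qcode (#|cylinder| - (m + 5)) 3 Q /\ is_pure 3 Q.
Proof.
move=> Sk dk leS.
(* With d outside the values of e^(m+3) - e, the companion matrix has no eigenvalue. *)
have [d d_val] := Xn_subX_not_onto 'F_p m.+2.
have e5 : (m.+3 + 2 = m + 5)%N by lia.
exists (point_code (companion m d) cylinder); rewrite -e5.
apply: point_code_correct => //.
- by move=> x c; apply: companion_noeig.
- exact: free_card Sk.
- by apply/rowP => i; rewrite summxE mxE; exact: free_moment1 Sk.
- exact: free_moment2 Sk dk.
- exact: cylinder_span.
- by rewrite e5.
- by apply: free_second_difference Sk dk _ => //; lia.
Qed.
End Cylinder.

(** * The quantum Hamming bound and the two families of codes *)

(** The term j = 2 alone is too large: 'C(N, 2) is at least 2N, and 2 (p^2 - 1)^2 exceeds p^4, so it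
    exceeds p^(m+5). The bound thus allows distance at most 4, one more than the distance
    attained. *)
Lemma qhamming_violated p m N :
  (3 <= p)%N -> (5 <= p ^ m.+1 <= N)%N -> (m + 5 <= N)%N ->
  ~~ qhamming_bound p N (N - (m + 5)) 5.
Proof.
move=> p_ge3 /andP[q_ge5 le_qN] le_mN.
rewrite /qhamming_bound subKn // -ltnNge !big_ord_recr big_ord0 /= add0n.
apply: leq_trans (leq_addl _ _).
have binN : (2 * N <= 'C(N, 2))%N by rewrite bin2; nia.
have -> : (p ^ (m + 5) = p ^ m.+1 * p ^ 4)%N by rewrite -expnD; congr (p ^ _)%N; lia.
have lt_p4 : (p ^ 4 < 2 * (p ^ 2 - 1) ^ 2)%N by nia.
apply: (@leq_trans (2 * N * (p ^ 2 - 1) ^ 2)); last by rewrite leq_mul2r binN orbT.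
rewrite [X in (_ < X * _)%N]mulnC -mulnA.
apply: leq_ltn_trans (_ : N * p ^ 4 < _)%N; first by rewrite leq_mul2r le_qN orbT.
by rewrite ltn_mul2l lt_p4 andbT; lia.
Qed.

Lemma exists_card_set (T : finType) k : (k <= #|T|)%N -> exists A : {set T}, #|A| = k.
Proof.
move=> le_k; exists [set x in take k (enum T)].
rewrite cardsE; have /card_uniqP -> : uniq (take k (enum T)) by rewrite take_uniq ?enum_uniq.
by rewrite size_takel // -cardE.
Qed.

Lemma cylinder_params p m (T : {set 'F_p * 'F_p}) :
  prime p -> odd p -> (p = 3 -> 0 < m)%N -> (p <= #|T|)%N ->
  (5 <= p ^ m.+1 <= #|cylinder m T|)%N /\ (m + 5 <= #|cylinder m T|)%N.
Proof.
move=> p_pr p_odd m_gt0 le_pT.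
have p_ge3 : (3 <= p)%N by have := prime_gt1 p_pr; have := p_odd; case: (p) => [|[|[]]] //; lia.
have le_q : (p ^ m.+1 <= #|cylinder m T|)%N.
  by rewrite card_cylinder // expnS leq_mul2r le_pT orbT.
(* The only failing case, p = 3 with m = 0, is excluded by [m_gt0]. *)
suff le_mq : (m + 5 <= p ^ m.+1)%N by rewrite le_q andbT; split; lia.
have [m0|m_gt0'] := posnP m.
  rewrite m0 expn1; move: (m_gt0) (p_odd); rewrite m0; case: (p) p_ge3 => [|[|[|[|[|q]]]]] //=.
  by move=> _ /(_ erefl).
apply: (@leq_trans (3 ^ m.+1)); last by rewrite leq_exp2r.
elim: m m_gt0' {m_gt0 le_q} => // [[//|m]] IHm _; rewrite expnS.
by have := IHm isT; lia.
Qed.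

(** Pigeonhole on the second components, of which there are only p. *)
Lemma large_set_varies p (T : {set 'F_p * 'F_p}) : prime p -> (p < #|T|)%N ->
  exists a a' b, [/\ a != a', (a, b) \in T & (a', b) \in T].
Proof.
move=> p_pr lt_pT.
have : ~~ injectiveb (fun u : {u | u \in T} => (val u).2).
  apply: contraL lt_pT => /injectiveP/leq_card.
  by rewrite card_sig card_Fp // -leqNgt.
case/injectivePn => [[[a b] abT] [[[a' b'] a'b'T]]] uv /= bb'; exists a, a', b; split => //.
  by apply: contraNneq uv => aa'; apply/eqP/val_inj; rewrite /= aa' bb'.
by rewrite bb'.
Qed.

Lemma cylinder_pure_code p m (T : {set 'F_p * 'F_p}) (k : 'I_m.+3) :
    prime p -> odd p -> (p = 3 -> 0 < m)%N -> (p <= #|T|)%N ->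
    (exists a a' b, [/\ a != a', (a, b) \in T & (a', b) \in T]) ->
    (m = 0%N -> exists a b b', [/\ b != b', (a, b) \in T & (a, b') \in T]) ->
    free_coord (cylinder m T) k ->
    p != 3 \/ (exists2 l : 'I_m.+3, l != k & free_coord (cylinder m T) l) ->
  exists N K : nat,
    [/\ N = (#|T| * p ^ m)%N, (K + m + 5 = N)%N,
        exists Q : {vspace qstate p N}, is_qcode K 3 Q /\ is_pure 3 Q
      & ~~ qhamming_bound p N K 5].
Proof.
move=> p_pr p_odd m_gt0 le_pT T0 T1 Sk dk.
have [leq le_S] := cylinder_params p_pr p_odd m_gt0 le_pT.
exists #|cylinder m T|, (#|cylinder m T| - (m + 5))%N; split.
- exact: card_cylinder.
- by rewrite -addnA subnK.
- exact: cylinder_code Sk dk le_S.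
- by apply: qhamming_violated => //; have := prime_gt1 p_pr; lia.
Qed.

Theorem theorem9 (p : nat) (eps0 : int) (n s : nat) :
  prime p -> odd p -> (eps0 = 1 \/ eps0 = -1) -> (p = 3%N -> (1 <= s)%N) ->
  (n = (4 + s)%N ->
     exists N K : nat,
       [/\ 2 * N%:Z = (p ^ n.-1)%N%:Z - eps0 * (p ^ (n - 3))%N%:Z,
           K%:Z = N%:Z - n%:Z - 2,
           (exists Q : {vspace qstate p N}, @is_qcode p N K 3 Q /\ @is_pure p N 3 Q)
         & ~~ qhamming_bound p N K 5])
  /\
  (n = (3 + s)%N ->
     exists N K : nat,
       [/\ 2 * N%:Z = (p ^ n.-1)%N%:Z + eps0 * (p ^ (n - 2))%N%:Z,
           K%:Z = N%:Z - n%:Z - 2,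
           (exists Q : {vspace qstate p N}, @is_qcode p N K 3 Q /\ @is_pure p N 3 Q)
         & ~~ qhamming_bound p N K 5]).
Proof.
move=> p_pr p_odd eps_val s_gt0.
have p_gt1 := prime_gt1 p_pr.
have p_ge3 : (3 <= p)%N by move: p_odd; case: (p) p_gt1 => [|[|[]]].
split=> ->.
  (* First family: m = s + 1 and T is any set of (p^2 - eps0)/2 pairs, since the middle coordinates
     already provide free directions. *)
  have [k [card_k lt_pk le_k]] : exists k : nat,
      [/\ 2 * k%:Z = (p ^ 2)%N%:Z - eps0, (p < k)%N & (k <= p ^ 2)%N].
    have p_half := odd_double_half p; rewrite p_odd in p_half.
    case: eps_val => ->.
      exists ((p ^ 2 - 1) %/ 2)%N; split; nia.
    exists ((p ^ 2 + 1) %/ 2)%N; split; nia.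
  have [|T cardT] := @exists_card_set ('F_p * 'F_p)%type k.
    by rewrite card_prod card_Fp // -expn2.
  have mid (j : nat) : (2 <= j <= s.+2)%N -> free_coord (cylinder s.+1 T) (inord j).
    by move=> jP; apply: cylinder_free_mid; rewrite inordK //; lia.
  have le_pT : (p <= #|T|)%N by rewrite cardT ltnW.
  have T0 : exists a a' b, [/\ a != a', (a, b) \in T & (a', b) \in T].
    by apply: large_set_varies; rewrite ?cardT.
  (* For p = 3, s is at least 1, so coordinates 2 and 3 are both free. *)
  have T_two_free : p != 3%N \/
      (exists2 l : 'I_s.+4, l != inord 2 & free_coord (cylinder s.+1 T) l).
    have [p3|] := eqVneq p 3%N; last by left.
    have s_pos := s_gt0 p3; right; exists (inord 3); last exact: mid.
    by rewrite -val_eqE /= !inordK.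
  have [//|//|N [K [defN defK codeQ bound]]] :=
    cylinder_pure_code p_pr p_odd _ le_pT T0 _ (mid 2 isT) T_two_free.
  exists N, K; split => //; last by lia.
  rewrite defN cardT PoszM mulrA card_k (_ : (4 + s).-1 = 2 + s.+1)%N; last by lia.
  by rewrite (_ : (4 + s - 3) = s.+1)%N ?expnD ?PoszM ?mulrBl //; lia.
(* Second family: m = s and T = F_p x B with B of size (p + eps0)/2, so coordinate 0 is free even
   when s = 0. *)
have [k [card_k lt_k le_k]] : exists k : nat,
    [/\ 2 * k%:Z = p%:Z + eps0, (0 < k)%N /\ ((5 <= p)%N -> (1 < k)%N) & (k <= p)%N].
  have p_half := odd_double_half p; rewrite p_odd in p_half.
  case: eps_val => ->.
    exists ((p + 1) %/ 2)%N; split; lia.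
  exists ((p - 1) %/ 2)%N; split; lia.
have [|B cardB] := @exists_card_set 'F_p k; first by rewrite card_Fp.
pose T := setX [set: 'F_p] B.
have cardT : #|T| = (p * k)%N by rewrite cardsX cardsT card_Fp // cardB.
have [b bB] : exists b, b \in B by apply/card_gt0P; rewrite cardB; case: lt_k.
have le_pT : (p <= #|T|)%N by rewrite cardT leq_pmulr //; case: lt_k.
have T0 : exists a a' b, [/\ a != a', (a, b) \in T & (a', b) \in T].
  by exists 0, 1, b; rewrite !inE bB eq_sym oner_neq0.
(* With s = 0, p is at least 5, and B then has two elements even for eps0 = -1. *)
have T1 : s = 0%N -> exists a b b', [/\ b != b', (a, b) \in T & (a, b') \in T].
  move=> s0; have p_ge5 : (5 <= p)%N.
    move: s_gt0 p_odd; rewrite s0; case: (p) p_ge3 => [|[|[|[|[|q]]]]] //=.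
    by move=> _ /(_ erefl).
  have /card_gt1P[b1 [b2 [b1B b2B b12]]] : (1 < #|B|)%N by rewrite cardB; case: lt_k => _; apply.
  by exists 0, b1, b2; rewrite !inE b1B b2B.
have T_free0 : free_coord (cylinder s T) 0 by apply: cylinder_free0 => a a' c; rewrite !inE.
have T_two_free : p != 3%N \/
    (exists2 l : 'I_s.+3, l != 0 & free_coord (cylinder s T) l).
  have [p3|] := eqVneq p 3%N; last by left.
  have s_pos := s_gt0 p3; right; exists (inord 2); first by rewrite -val_eqE /= inordK.
  by apply: cylinder_free_mid; rewrite inordK.
have [N [K [defN defK codeQ bound]]] :=
  cylinder_pure_code p_pr p_odd s_gt0 le_pT T0 T1 T_free0 T_two_free.
exists N, K; split => //; last by lia.
have -> : ((3 + s).-1 = s + 2)%N by lia.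
have -> : (3 + s - 2 = s + 1)%N by lia.
rewrite defN cardT !expnD expn1 -mulnn !PoszM [p%:Z * k%:Z]mulrC !mulrA card_k; ring.
Qed.
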